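(* Let $\mathcal{O}$ be the ring of $S$-integers in a number field and let $\mathcal{B}=\{\beta,\beta^*\}$ be the multi-set of roots of $Ax^2+Bx+C$ with $A,B,C\in\mathcal{O}$ not all zero. If $V(\mathcal{B})_{0,1}\neq\emptyset$ and $\beta+\beta^*=0$, then $\beta=\pm1$. In particular, for $n\ge0$ the variety $V(2+\alpha_n)_{0,1}$ is empty, and there are no $\mathbb{Z}[\alpha_n]$-PCFs for $\alpha_{n+1}$ of type $(0,1)$.
   Context: For $n\ge-1$, $\alpha_n=2\cos(2\pi/2^{n+2})$, so $\alpha_{n+1}^2=2+\alpha_n$. With $E=\begin{bmatrix}E_{11}&E_{12}\\ E_{21}&E_{22}\end{bmatrix}=\begin{bmatrix}x_1&1\\1&0\end{bmatrix}$, the PCF variety $V(\mathcal{B})_{0,1}\subseteq\mathbb{A}^1$ is defined by $A(E_{22}-E_{11})=BE_{21}$, $-AE_{12}=CE_{21}$, $-BE_{12}=C(E_{22}-E_{11})$, i.e. $-Ax_1=B$, $-A=C$, $-B=-Cx_1$. Roots are taken in $\mathbb{P}^1(\overline{\mathbb{Q}})$, with one root (resp. both) equal to $\infty$ if $A=0$ (resp. $A=B=0$). $V(2+\alpha_n)_{0,1}$ denotes $V(\mathcal{B})_{0,1}$ for $\mathcal{B}=\{\alpha_{n+1},-\alpha_{n+1}\}$, i.e. $(A,B,C)=(1,0,-(2+\alpha_n))$. A $\mathbb{Z}[\alpha_n]$-PCF of type $(0,1)$ for $\alpha_{n+1}$ is a periodic continued fraction $[\overline{a_1}]=[a_1,a_1,a_1,\ldots]$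 with $a_1\in\mathbb{Z}[\alpha_n]$ whose value is $\alpha_{n+1}$; the value is the limit in $\mathbb{P}^1(\mathbb{C})$, if it exists, of the finite continued fractions $M_{11}/M_{21}$, $M=\begin{bmatrix}a_1&1\\1&0\end{bmatrix}^m$, as $m\to\infty$. *)

(* Defs.v *)
From HB Require Import structures.
From mathcomp Require Import all_boot all_order all_algebra all_field.
From mathcomp Require Import all_classical all_reals all_analysis.
From mathcomp Require Import complex.

Set Implicit Arguments.
Unset Strict Implicit.
Unset Printing Implicit Defensive.

Import Order.TTheory GRing.Theory Num.Theory.
Import numFieldTopology.Exports numFieldNormedType.Exports.

Local Open Scope classical_set_scope.
Local Open Scope ring_scope.

Section SIntegers.
Variable K : fieldExtType rat.

Definition ring_of_integers : set K :=
  [set x | integralOver (intr : int -> K) x].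

(* A nonarchimedean place of K is represented by the corresponding nonzero
   prime ideal of the ring of integers. *)
Definition finite_place : set (set K) :=
  [set P | P `<=` ring_of_integers /\
           P 0 /\
           (forall x y, P x -> P y -> P (x + y)) /\
           (forall a x, ring_of_integers a -> P x -> P (a * x)) /\
           ~ P 1 /\
           (forall x y, ring_of_integers x -> ring_of_integers y ->
              P (x * y) -> P x \/ P y) /\
           (exists2 x, P x & x != 0)].

(* The valuation ring of the place P, i.e. the localization at P of the ring
   of integers. *)
Definition integral_at (P : set K) : set K :=
  [set x | exists a b, [/\ ring_of_integers a, ring_of_integers b,
                           ~ P b & x * b = a]].

(* S lists only the nonarchimedean places: the archimedean ones impose no
   condition on S-integers. *)
Definition S_integers (S : set (set K)) : set K :=
  [set x | forall P, finite_place P -> ~ S P -> integral_at P x].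

End SIntegers.

(* P^1(F), with None the point at infinity; for the complex numbers the
   topology carried by this type is that of the Riemann sphere. *)
Definition P1 (F : Type) : Type := one_point_compactification F.

Definition P1_frac (F : fieldType) (x y : F) : P1 F :=
  if y == 0 then None else Some (x / y).

(* {b, b'} is the multiset of roots in P^1(F) of A x^2 + B x + C.  For F the
   complex numbers and algebraic A, B, C, not all zero, the roots lie in
   P^1(Qbar). *)
Definition P1_roots (F : fieldType) (A B C : F) (b b' : P1 F) : Prop :=
  let f : {poly F} := A *: 'X^2 + B *: 'X + C%:P in
  match b, b' with
  | Some r, Some s => A != 0 /\ f = A *: (('X - r%:P) * ('X - s%:P))
  | Some r, None | None, Some r => [/\ A = 0, B != 0 & f = B *: ('X - r%:P)]
  | None, None => [/\ A = 0, B = 0 & C != 0]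
  end.

(* b + b' = 0; a sum with a point at infinity is infinite or undefined, and
   never 0. *)
Definition P1_sum0 (F : fieldType) (b b' : P1 F) : Prop :=
  match b, b' with
  | Some r, Some s => r + s = 0
  | _, _ => False
  end.

Definition cf_matrix (F : nzRingType) (a : F) : 'M[F]_2 :=
  \matrix_(i < 2, j < 2) nth 0 (nth [::] [:: [:: a; 1]; [:: 1; 0]] i) j.

(* The F-points of V(B)_{0,1}, for B the multiset of roots of
   A x^2 + B x + C.  The variety is empty iff it has no point over some (any)
   algebraically closed field F containing A, B, C. *)
Definition pcf_variety01 (F : fieldType) (A B C : F) : set F :=
  [set x1 | let E := cf_matrix x1 in
     let E11 := E 0 0 in let E12 := E 0 1 in
     let E21 := E 1 0 in let E22 := E 1 1 in
     [/\ A * (E22 - E11) = B * E21,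
         - A * E12 = C * E21 &
         - B * E12 = C * (E22 - E11)]].

(* M_11 / M_21 for M the m-th power of cf_matrix a. *)
Definition pcf01_convergent (F : fieldType) (a : F) (m : nat) : P1 F :=
  let M := cf_matrix a ^+ m in P1_frac (M 0 0) (M 1 0).

Definition pcf01_value (F : numFieldType) (a x : F) : Prop :=
  pcf01_convergent a m @[m --> \oo] --> (Some x : P1 F).

(* The subring Z[c] of F. *)
Definition Zadjoin (F : nzRingType) (c : F) : set F :=
  [set x | exists p : {poly int}, x = (map_poly intr p).[c]].

Definition alpha (R : realType) (n : nat) : R[i] :=
  (2 * cos (2 * pi / 2 ^+ (n + 2)) : R)%:C%C.

Definition is_pcf01 (R : realType) (O : set R[i]) (x a1 : R[i]) : Prop :=
  O a1 /\ pcf01_value a1 x.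

(* Main.v *)
Require Import Defs.
From HB Require Import structures.
From mathcomp Require Import all_boot all_order all_algebra all_field.
From mathcomp Require Import all_classical all_reals all_analysis.
From mathcomp Require Import complex ring zify.

(** A value [x] of [[a, a, a, ...]] satisfies [x ^ 2 = a x + 1], that is
    [x (x - a) = 1], so a purely periodic expansion of type (0,1) with an
    algebraic integer [a] would make [alpha_(n+1)] a unit among the algebraic
    integers.  This is impossible because [alpha_(n+1)] lies above 2: squaring
    a relation [2 u + alpha_(n+1) v = 1] gives a relation of the same shape for
    [alpha_n], and at [alpha_0 = 0] it says that [1 / 2] is integral. *)

Import Order.TTheory GRing.Theory Num.Theory.
Import numFieldTopology.Exports numFieldNormedType.Exports.

Local Open Scope classical_set_scope.
Local Open Scope ring_scope.

(** Clearing denominators: if [u] were 1/2, multiplying its monic equation of degree [d] by [2 ^+ d]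
    would turn the leading term into 1 and every other term into an even integer, so an odd integer
    would vanish. *)
Lemma integral_int_double_neq1 (F : numDomainType) (u : F) :
  integralOver (intr : int -> F) u -> 2 * u != 1.
Proof.
case=> p p_monic /rootP pu0; apply/eqP => u2.
pose d := (size p).-1.
have size_p : size p = d.+1 by rewrite prednK // size_poly_gt0 monic_neq0.
have pd : p`_d = 1 by rewrite -(monicP p_monic) lead_coefE.
have scale (i : nat) : (i <= d)%N -> 2 ^+ d * u ^+ i = 2 ^+ (d - i) :> F.
  by move=> le_id; rewrite -{1}(subnK le_id) exprD -mulrA -exprMn u2 expr1n mulr1.
(* Half the sum of the non-leading terms after scaling; the predecessor in the exponent is harmless
   since [i < d]. *)
pose k : int := \sum_(i < d) p`_i * 2 ^+ (d - i).-1.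
have odd0 : (1 + 2 * k)%:~R = 0 :> F.
  rewrite -[RHS](mulr0 (2 ^+ d)) -pu0 horner_coef size_map_poly_id0; last first.
    by rewrite (monicP p_monic) oner_neq0.
  rewrite size_p big_ord_recr /= coef_map /= pd mulrDr mul1r scale // subnn expr0.
  rewrite addrC rmorphD rmorph1 rmorphM /=; congr (_ + _).
  rewrite rmorph_sum !mulr_sumr; apply: eq_bigr => i _.
  rewrite coef_map /= [RHS]mulrCA scale; last exact: ltnW.
  rewrite rmorphM rmorphXn /= mulrCA -exprS prednK // subn_gt0.
  exact: ltn_ord.
have /eqP : 1 + 2 * k = 0 by apply/eqP; rewrite -(@intr_eq0 F) odd0.
by move=> /eqP; lia.
Qed.

Lemma Zadjoin_integral (F : comNzRingType) (c x : F) :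
  integralOver (intr : int -> F) c -> Zadjoin c x ->
  integralOver (intr : int -> F) x.
Proof.
move=> c_int [p ->]; apply: integral_horner => //.
by apply/integral_poly => i; rewrite coef_map; exact: integral_id.
Qed.

Lemma alpha0 (R : realType) : alpha R 0 = 0.
Proof.
rewrite /alpha add0n (_ : 2 * pi / 2 ^+ 2 = pi / 2 :> R); last by field.
by rewrite cos_pihalf mulr0.
Qed.

Lemma alphaS_sqr (R : realType) (n : nat) :
  alpha R n.+1 ^+ 2 = 2 + alpha R n.
Proof.
rewrite /alpha; set t : R := 2 * pi / 2 ^+ (n.+1 + 2).
have -> : 2 * pi / 2 ^+ (n + 2) = t *+ 2 :> R.
  by rewrite /t addSn exprS; field; rewrite expf_neq0.
rewrite cos_mulr2n -[2 in RHS](rmorph_nat (real_complex R)) -rmorphD -rmorphXn /=.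
by congr (_%:C)%C; ring.
Qed.

Lemma alpha_integral (R : realType) (n : nat) :
  integralOver (intr : int -> R[i]) (alpha R n).
Proof.
elim: n => [|n IHn]; first by rewrite alpha0; exact: mxpoly.integral0.
have int2a : integralOver (intr : int -> R[i]) (2 + alpha R n).
  by apply: integral_add => //; exact: integral_nat.
apply: (@integral_root_monic _ _ _ _ ('X^2 - (2 + alpha R n)%:P)).
- by rewrite monicXnsubC.
- by rewrite /root !hornerE alphaS_sqr subrr.
- apply/integral_poly => i; rewrite coefB coefXn coefC.
  apply: integral_sub; first exact: integral_nat.
  by case: ifP => _ //; exact: mxpoly.integral0.
Qed.

Lemma alpha_2_proper (R : realType) (n : nat) (u v : R[i]) :
  integralOver (intr : int -> R[i]) u -> integralOver (intr : int -> R[i]) v ->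
  2 * u + alpha R n * v != 1.
Proof.
elim: n u v => [|n IHn] u v int_u int_v.
  by rewrite alpha0 mul0r addr0; exact: integral_int_double_neq1.
apply/eqP => uv1.
have int_2 : integralOver (intr : int -> R[i]) 2 by exact: integral_nat.
have int_v2 : integralOver (intr : int -> R[i]) (v ^+ 2).
  by rewrite expr2; exact: integral_mul.
(* Squaring [1 - 2 * u = alpha R n.+1 * v] gives [1 - 4 * u + 4 * u ^+ 2 = (2 + alpha R n) * v ^+
   2]; this element is the resulting cofactor of 2, and [v ^+ 2] that of [alpha R n]. *)
have int_w : integralOver (intr : int -> R[i]) (2 * u - 2 * (u * u) + v ^+ 2).
  apply: integral_add => //.
  by apply: integral_sub; do ?[exact: integral_mul | apply: integral_mul => //].
move/eqP: (IHn _ _ int_w int_v2); apply.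
have sq : (1 - 2 * u) ^+ 2 = (2 + alpha R n) * v ^+ 2.
  rewrite -alphaS_sqr -exprMn; congr (_ ^+ 2).
  by apply/eqP; rewrite subr_eq addrC uv1.
by rewrite mulrDr -addrA -mulrDl -sq; ring.
Qed.

(** The affine line is open in [P1 F], so a sequence with a finite limit eventually avoids infinity,
    and the default 0 does not affect the limit. *)
Lemma cvg_P1_finite (F : numFieldType) (f : nat -> P1 F) (x : F) :
  f m @[m --> \oo] --> (Some x : P1 F) ->
  (\forall m \near \oo, f m = Some (odflt 0 (f m))) /\
  odflt 0 (f m) @[m --> \oo] --> x.
Proof.
move=> cvf.
have near_image (U : set F) : nbhs x U ->
    \forall m \near \oo, (Some @` U : set (P1 F)) (f m).
  by move=> xU; apply: cvf; exact: one_point_compactification_some_nbhs.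
split.
  by apply: filterS (near_image setT filterT) => m [z _ /= <-].
by move=> U xU; apply: filterS (near_image U xU) => m [z Uz /= <-].
Qed.

Lemma cf_matrixXS (F : nzRingType) (a : F) (m : nat) :
  (cf_matrix a ^+ m.+1) 0 0 = a * (cf_matrix a ^+ m) 0 0 + (cf_matrix a ^+ m) 1 0 /\
  (cf_matrix a ^+ m.+1) 1 0 = (cf_matrix a ^+ m) 0 0.
Proof.
by rewrite exprS !mxE !big_ord_recl !big_ord0 !mxE /= !mul1r !mul0r !addr0
  (_ : lift _ _ = 1) //; apply/val_inj.
Qed.

(** Consecutive convergents satisfy [z m.+1 * z m = a * z m + 1], and the limit is taken on both
    sides. The product form avoids dividing by a limit not yet known to be nonzero. *)
Lemma pcf01_value_root (F : numFieldType) (a x : F) :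
  pcf01_value a x -> x ^+ 2 = a * x + 1.
Proof.
move=> /cvg_P1_finite []; set z := fun m => odflt 0 (pcf01_convergent a m).
move=> fin cvz.
have cvzS : z m.+1 @[m --> \oo] --> x by rewrite cvg_shiftS.
have finS : \forall m \near \oo, pcf01_convergent a m.+1 = Some (z m.+1).
  by case: fin => N _ finN; exists N => // m /= Nm; apply: finN; exact: leqW.
have cv_prod : z m.+1 * z m @[m --> \oo] --> x * x by exact: cvgM.
have cv_lin : z m.+1 * z m @[m --> \oo] --> a * x + 1.
  have : a * z m + 1 @[m --> \oo] --> a * x + 1.
    by apply: cvgD; [apply: cvgM => //; exact: cvg_cst | exact: cvg_cst].
  apply: cvg_trans; apply: near_eq_cvg.
  apply: filterS2 fin finS => m.
  rewrite /z /pcf01_convergent /P1_frac.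
  have [-> ->] := cf_matrixXS _ a m.
  (* Finiteness at [m] and at [m.+1] makes both entries of the first column of the [m]-th power
     nonzero, the upper one being the next denominator. *)
  case: eqP => //= /eqP q0 _; case: eqP => //= /eqP p0 _.
  by field; rewrite q0 p0.
by rewrite expr2; exact: (cvg_unique _ cv_prod cv_lin).
Qed.

Lemma pcf_variety01E (F : fieldType) (A B C x : F) :
  pcf_variety01 A B C x <-> [/\ B = - (A * x), C = - A & B = C * x].
Proof.
rewrite /pcf_variety01 /= !mxE /= !mulr1 sub0r !mulrN.
by split=> -[h1 h2 h3]; split=> //; [exact: oppr_inj | rewrite h3].
Qed.

Theorem proposition5p1 (R : realType) :
  (forall (K : fieldExtType rat) (iota : {rmorphism K -> R[i]})
          (S : set (set K)) (A B C : K) (b b' : P1 R[i]),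
     finite_set S -> S `<=` @finite_place K ->
     S_integers S A -> S_integers S B -> S_integers S C ->
     ~ (A = 0 /\ B = 0 /\ C = 0) ->
     P1_roots (iota A) (iota B) (iota C) b b' ->
     pcf_variety01 (iota A) (iota B) (iota C) !=set0 ->
     P1_sum0 b b' ->
     b = Some 1 \/ b = Some (-1)) /\
  (forall n : nat, pcf_variety01 1 0 (- (2 + alpha R n)) = set0) /\
  (forall n : nat,
     ~ exists a1 : R[i], is_pcf01 (Zadjoin (alpha R n)) (alpha R n.+1) a1).
Proof.
split; last split.
- move=> K iota S A B C [r|] [s|] _ _ _ _ _ _ //= [A0 fE] [x].
  move=> /pcf_variety01E[_ CA _] /eqP; rewrite addr_eq0 => /eqP rs.
  (* Constant coefficients give [C = A * r * s], where [C = - A] on the variety and [s = - r]. *)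
  have : r ^+ 2 = 1.
    apply: (mulfI A0); move/(congr1 (coefp 0)): fE.
    rewrite /= coefD coefD !coefZ coefXn coefX coefC /= !mulr0 !add0r CA.
    rewrite coefM big_ord1 !coefB !coefX !coefC /= !sub0r mulrNN mulr1 rs.
    by rewrite sqrrN expr2 mulNr mulrN => /oppr_inj <-.
  by move=> /eqP; rewrite sqrf_eq1 => /orP[] /eqP ->; [left | right].
- move=> n; apply/seteqP; split=> // x /pcf_variety01E[_ /oppr_inj h _].
  (* A point would force [2 + alpha R n = 1], a forbidden relation with [u = v = 1]. *)
  have int1 := integral1 (intr : int -> R[i]).
  by have := alpha_2_proper R n _ _ int1 int1; rewrite !mulr1 h eqxx.
- move=> n [a [a_int /pcf01_value_root x2]].
  have int_a := Zadjoin_integral _ _ _ (alpha_integral R n) a_int.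
  have int_x := alpha_integral R n.+1.
  have int_xa := integral_sub int_x int_a.
  (* Here [u = 0], and [v = alpha R n.+1 - a] is the inverse of [alpha R n.+1]. *)
  move/eqP: (alpha_2_proper R n.+1 0 _ (mxpoly.integral0 _) int_xa).
  by apply; rewrite mulr0 add0r mulrBr -expr2 x2; ring.
Qed.
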